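(* Let $r\geq 3$ and $\ell\geq 4$ be integers. Then for every positive integer $n$, $$\mathrm{ex}_r^{\mathrm{lin}}(n,P_\ell^r)\leq \frac{(2r-3)\ell}{2}\,n.$$
   Context: An $r$-graph ($r$-uniform hypergraph) $H=(V(H),E(H))$ is a finite vertex set together with a set of $r$-element subsets of it (edges). It is linear if any two distinct edges intersect in at most one vertex. The $r$-uniform linear path $P_\ell^r$ of length $\ell$ is the $r$-graph with edges $e_1,\dots,e_\ell$ such that $|e_i\cap e_j|=1$ if $|i-j|=1$ and $e_i\cap e_j=\emptyset$ for all other $i\neq j$ (with no vertices outside these edges). An $r$-graph $H$ is $F$-free if it contains no copy of $F$ as a (not necessarily induced) subgraph. The linear Turán number $\mathrm{ex}_r^{\mathrm{lin}}(n,F)$ is the maximum number of edges in an $F$-free linear $r$-graph on $n$ vertices. *)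

(* Defs.v *)
From HB Require Import structures.
From mathcomp Require Import all_boot all_order all_algebra zify.

Set Implicit Arguments.
Unset Strict Implicit.
Unset Printing Implicit Defensive.

Record hypergraph := Hypergraph {
  vertices : finType;
  edges : {set {set vertices}}
}.

Definition uniform (r : nat) (H : hypergraph) : bool :=
  [forall e in edges H, #|e| == r].

Definition linear_hypergraph (H : hypergraph) : bool :=
  [forall e in edges H, forall f in edges H, (e != f) ==> (#|e :&: f| <= 1)].

(* A copy of F in H: an injection of the vertices sending edges to edges;
   non-edges are unconstrained, so the copy need not be induced. *)
Definition contains_copy (F H : hypergraph) : bool :=
  [exists f : {ffun vertices F -> vertices H},
     injectiveb f && [forall e in edges F, f @: e \in edges H]].

Definition copy_free (F H : hypergraph) : bool := ~~ contains_copy F H.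

(* P is (a realisation of) the r-uniform linear path with l edges; it is
   determined up to isomorphism.  The last clause excludes isolated vertices. *)
Definition is_linear_path (r l : nat) (P : hypergraph) : Prop :=
  uniform r P /\
  exists e : 'I_l -> {set vertices P},
    [/\ edges P = [set e i | i : 'I_l],
        forall i j : 'I_l, (`|i%:Z - j%:Z| = 1)%R -> #|e i :&: e j| = 1,
        forall i j : 'I_l, i != j -> (`|i%:Z - j%:Z| != 1)%R ->
          e i :&: e j = set0
      & \bigcup_(i < l) e i = [set: vertices P]].

(* The vertex set is taken to be 'I_n, which loses nothing: all the notions
   involved are invariant under isomorphism (see ex_lin_max). *)
Definition ex_lin (r n : nat) (F : hypergraph) : nat :=
  \max_(E : {set {set 'I_n}} |
          [&& uniform r (Hypergraph E), linear_hypergraph (Hypergraph E)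
            & copy_free F (Hypergraph E)]) #|E|.

Lemma ex_lin_max (r n : nat) (F H : hypergraph) :
  #|vertices H| = n -> uniform r H -> linear_hypergraph H -> copy_free F H ->
  #|edges H| <= ex_lin r n F.
Proof.
case: H => V E /= cV; subst n => /forall_inP/= uE /forall_inP/= lE fE.
pose h (x : V) := enum_rank x.
have hI : injective h by exact: enum_rank_inj.
have HI : injective (fun e : {set V} => h @: e) by exact: imset_inj.
pose E' : {set {set 'I_#|V|}} := [set h @: (e : {set V}) | e in E].
rewrite -(card_imset (mem E) HI); apply: (@leq_bigmax_cond _ _ _ E').
apply/and3P; split.
- apply/forall_inP => _ /imsetP[e eE ->]; rewrite card_imset //.
  exact: uE.
- apply/forall_inP => _ /imsetP[e eE ->]; apply/forall_inP => _ /imsetP[f fE' ->].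
  rewrite -imsetI ?card_imset; [|exact: hI|by move=> ? ? _ _; exact: hI].
  apply/implyP => ne; have /forall_inP/(_ f fE')/implyP := lE e eE.
  by apply; apply: contraNneq ne => ->.
- apply: contra fE => /existsP[g /andP[/injectiveP gI /forall_inP gE]].
  apply/existsP; exists [ffun x => enum_val (g x)]; apply/andP; split.
    apply/injectiveP => x y; rewrite !ffunE => /enum_val_inj; exact: gI.
  apply/forall_inP => e /gE /imsetP[e' e'E eq].
  suff -> : [ffun x => enum_val (g x)] @: e = e' by [].
  apply: HI; rewrite -eq -imset_comp; apply: eq_imset => x /=.
  by rewrite ffunE /h enum_valK.
Qed.

Lemma linear_path_exists (r l : nat) :
  2 <= r -> 1 <= l -> exists P, is_linear_path r l P.
Proof.
case: r => [|[|s]] // _; case: l => // l _.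
pose r := s.+1; pose N := (l.+1 * r).+1.
pose e (i : 'I_l.+1) := [set k : 'I_N | i * r <= k <= i.+1 * r].
have lt_e (i : 'I_l.+1) x : x <= i.+1 * r -> x < N.
  by move=> h; rewrite ltnS (leq_trans h) // leq_mul2r ltn_ord orbT.
have cap1 (i j : 'I_l.+1) : j = i.+1 :> nat -> #|e i :&: e j| = 1.
  move=> ji; rewrite -(cards1 (Ordinal (lt_e i _ (leqnn _)))).
  congr #|pred_of_set _|; apply/setP => k; rewrite !inE ji -val_eqE /= eqn_leq.
  by rewrite !mulSn; case: (k : nat) => *; lia.
have cap0 (i j : 'I_l.+1) : i.+1 < j -> e i :&: e j = set0.
  move=> ij; apply/setP => k; rewrite !inE; apply/negP.
  case/andP => /andP[_ h1] /andP[h2 _].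
  have : i.+2 * r <= i.+1 * r.
    by apply: leq_trans h1; apply: leq_trans h2; rewrite leq_mul2r ij orbT.
  by rewrite leq_mul2r /r /= ltnn.
exists (Hypergraph [set e i | i : 'I_l.+1]); split.
  apply/forall_inP => _ /imsetP[i _ ->].
  have bd (k : 'I_r.+1) : i * r + k < N.
    by apply: (lt_e i); rewrite mulSn addnC leq_add2r -ltnS.
  pose g k := Ordinal (bd k).
  have gI : injective g by move=> a b /(congr1 val)/= /addnI /val_inj.
  suff -> : e i = g @: setT by rewrite card_imset // cardsT card_ord.
  apply/setP => k; rewrite inE; apply/idP/imsetP => [/andP[h1 h2]|[a _ ->]] /=.
    have hk : k - i * r < r.+1 by rewrite ltnS leq_subLR addnC -mulSn.
    by exists (Ordinal hk) => //; apply: val_inj; rewrite /= subnKC.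
  by rewrite leq_addr mulSn addnC leq_add2r -ltnS ltn_ord.
exists e; split => //.
- move=> i j h; have [h'|h'] : j = i.+1 :> nat \/ i = j.+1 :> nat by lia.
    exact: cap1.
  by rewrite setIC; exact: cap1.
- move=> i j /eqP ne h; have ne' : (i : nat) <> j by move/val_inj.
  have [h'|h'] : i.+1 < j \/ j.+1 < i by lia.
    exact: cap0.
  by rewrite setIC; exact: cap0.
- apply/setP => k; rewrite inE; apply/bigcupP.
  have [kl|kl] := ltnP (k %/ r) l.+1.
    exists (Ordinal kl) => //; rewrite inE /= leq_divM /=.
    by apply: ltnW; rewrite ltn_ceil.
  exists ord_max => //; rewrite inE /=.
  rewrite (_ : k <= l.+1 * r) ?andbT -1?ltnS //; move: kl; rewrite leq_divRL // => kl.
  by apply: leq_trans kl; rewrite leq_mul2r leqnSn orbT.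
Qed.

(* Main.v *)
Require Import Defs.
From mathcomp Require Import all_boot all_order all_algebra.
From mathcomp Require Import zify lra.

Set Implicit Arguments.
Unset Strict Implicit.
Unset Printing Implicit Defensive.

(** Put c = (2r-3)l and suppose that 2|E| > cn.  A smallest vertex set W which
    spans more than c|W|/2 edges spans a subfamily in which every vertex that
    is covered at all has degree greater than c/2 ([dense_core]).  It remains
    to find a linear path with l edges under this minimum degree condition.

    Plain greedy extension of a path needs minimum degree about (r-1)l; the
    missing l/2 comes from a rotation argument at both ends of a longest path.
    Let p_0, ..., p_(k-1) be a path with 2 <= k < l that cannot be replaced by
    a path with k+1 edges, S its vertex set, U = p_0 \ p_1 and
    W = p_(k-1) \ p_(k-2) its two sets of r-1 end vertices.  For u in U, the
    edges through u other than p_0 are disjoint outside u, and each of them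
    meets S \ p_0.  Those that meet it twice use up two vertices, so
      2 (deg u - 1) <= |S \ p_0| + #{x in S \ p_0 : f :&: S = {u, x}
                                    for some edge f}        ([end_degree_le]),
    and likewise at the other end.

    The last term cannot be large at both ends.  Let x be the vertex common to
    p_i and p_(i+1), let y lie on p_i and on no other edge of the path, and let
    f :&: S = {u, x} and g :&: S = {w, y} with u in U and w in W.  The sequence
      p_(i-1), ..., p_0, f, p_(i+1), ..., p_(k-1)
    is again a path with k edges ending in w, and it no longer contains y; so g
    would prolong it unless f and g meet outside S ([path_conflict]).  Since g
    has only r-2 vertices outside S and the edges f through a fixed x are
    disjoint elsewhere, at most r-2 of the r-1 vertices u can occur.  Applied
    in both directions, this shows that among the (r-1)^2 pairs formed by the
    vertices u with x and the w with the private vertices y of p_i, at least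
    r-1 are not realised ([contacts_conflict]).  Together with the mirror image
    this saves 2(r-1) for every inner edge of the path; summing the degree
    bounds over U and W then contradicts the minimum degree
    ([no_shorter_path]).

    Finally, a family of l edges in the pattern of a linear path contains a
    copy of every realisation P of that path: a vertex is described, up to
    permutation of its class, by the set of edges which contain it, and the
    sizes of these classes are determined by r and by the intersection sizes
    ([eq_card_fiber], [linear_path_copy]). *)

(** * Counting *)

Lemma leq_sum_cover (T : finType) (W : {set T}) (A : nat -> {set T}) m n
    (F : T -> nat) :
  (forall x, x \in W -> exists2 i, m <= i < n & x \in A i) ->
  \sum_(x in W) F x <= \sum_(m <= i < n) \sum_(x in A i) F x.
Proof.
move=> cov.
under [X in _ <= X]eq_bigr do rewrite big_mkcond.
rewrite exchange_big [X in X <= _]big_mkcond /=; apply: leq_sum => x _.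
case: ifP => // /cov[i ib xi].
rewrite (bigD1_seq i) ?mem_index_iota ?iota_uniq //= xi; lia.
Qed.

(** The final count for a path with [m.+2] edges, with s = r - 2 and d the
    minimum degree: [A] and [B] are the contacts of the two ends with the inner
    edges, [a] and [b] those with the edge at the opposite end. *)
Lemma path_count_arith s m d A B a b : 0 < s ->
  A + B <= m * (2 * (s.+1 * s)) -> a <= s.+1 * s.+1 -> b <= s.+1 * s.+1 ->
  s.+1 * (2 * d) <= s.+1 * 2 + m.+1 * s.+1 ^ 2 + (A + a) ->
  s.+1 * (2 * d) <= s.+1 * 2 + m.+1 * s.+1 ^ 2 + (B + b) ->
  2 * d <= (2 * s + 1) * m.+3.
Proof.
move=> s0 AB la lb HA HB.
have : s.+1 * (4 * d) <= s.+1 * (4 + 2 * m.+2 * s.+1 + m * (2 * s)) by lia.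
rewrite leq_pmul2l // => H; have ms : m * s = s * m by rewrite mulnC.
by lia.
Qed.

(** * Linear paths in a linear uniform family of edges *)

Section LinearPaths.
Variables (T : finType) (E : {set {set T}}) (r : nat).
Hypothesis uniE : forall e, e \in E -> #|e| = r.
Hypothesis linE : forall e f, e \in E -> f \in E -> e != f -> #|e :&: f| <= 1.
Implicit Types (p : nat -> {set T}) (k i j : nat) (S U W : {set T}).

Lemma edge_unique e f x y : e \in E -> f \in E -> x != y ->
  x \in e -> y \in e -> x \in f -> y \in f -> e = f.
Proof.
move=> eE fE xy xe ye xf yf; apply/eqP; apply: contraT => /(linE eE fE).
have : #|[set x; y]| <= #|e :&: f|.
  by apply/subset_leq_card/subsetP => z /set2P[]->; rewrite inE ?xe ?ye.
rewrite cards2 xy; lia.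
Qed.

(** Paths are functions on [nat] of which only the first [k] values matter, so
    that reversal, rotation and extension are index computations.  The edges
    are distinct because they have more than one vertex when 1 < r. *)
Definition linear_path k p :=
  (forall i, i < k -> p i \in E) /\
  (forall i j, i < j < k -> #|p i :&: p j| = (j == i.+1)).

Definition span k p := \bigcup_(i < k) p i.

Definition flip k p : nat -> {set T} := fun i => p (k.-1 - i).

Lemma spanP k p x : reflect (exists2 i, i < k & x \in p i) (x \in span k p).
Proof.
apply: (iffP bigcupP) => [[i _ xi]|[i ik xi]]; first by exists i.
by exists (Ordinal ik).
Qed.

Lemma span_flip k p : span k (flip k p) = span k p.
Proof.
by apply/setP => x; apply/spanP/spanP => -[i ik xi]; exists (k.-1 - i);
  rewrite /flip ?subKn //; lia.
Qed.

Lemma linear_path_flip k p : linear_path k p -> linear_path k (flip k p).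
Proof.
move=> [pE pI]; split=> [i ik|i j ijk]; first by apply: pE; lia.
rewrite setIC pI; last by lia.
by congr nat_of_bool; lia.
Qed.

Lemma linear_path_meet k p i j x : linear_path k p -> i < j < k ->
  x \in p i -> x \in p j -> j = i.+1.
Proof.
move=> [_ pI] ijk xi xj; apply/eqP; apply: contraT => /negbTE ne.
have := pI _ _ ijk; rewrite ne => /eqP; rewrite cards_eq0 => /eqP/setP/(_ x).
by rewrite !inE xi xj.
Qed.

Lemma linear_path_rcons k p g : 0 < k -> linear_path k p -> g \in E ->
  #|p k.-1 :&: g| = 1 -> (forall i, i < k.-1 -> p i :&: g = set0) ->
  linear_path k.+1 (fun i => if i < k then p i else g).
Proof.
move=> k0 [pE pI] gE g1 g0; split=> [i _|i j ijk]; first by case: ifP => // /pE.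
have -> : i < k by lia.
case: ifP => jk; first by apply: pI; lia.
have [-> /=|ne] := eqVneq i k.-1; first by rewrite g1; lia.
by rewrite g0 ?cards0; lia.
Qed.

(** An edge [f] from an end vertex [u] to the common vertex [x] of [p i] and
    [p i.+1] lets one walk through the first [i] edges backwards, jump along
    [f], and continue as before.  The edge [f] takes the place of [p i], whose
    private vertices are thereby set free. *)
Lemma linear_path_rotate k p i f u x : linear_path k p -> 0 < i -> i.+1 < k ->
  f \in E -> f :&: span k p = [set u; x] -> u \in p 0 :\: p 1 ->
  x \in p i :&: p i.+1 ->
  linear_path k (fun j => if j < i then p (i.-1 - j)
                          else if j == i then f else p j).
Proof.
move=> pP i0 ik fE fS uU /setIP[xi xi1]; have [pE pI] := pP.
have fp j : j < k -> f :&: p j = [set u; x] :&: p j.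
  move=> jk; rewrite -fS -setIA; congr (_ :&: _); apply/esym/setIidPr.
  by apply/subsetP => y yj; apply/spanP; exists j.
move: uU; rewrite inE => /andP[u1 u0].
have uj j : 0 < j < k -> u \notin p j.
  move=> jk; apply: contra u1 => uj.
  by rewrite -(linear_path_meet pP jk u0 uj).
have xj j : j < k -> x \in p j -> (j == i) || (j == i.+1).
  move=> jk xj; apply: contraT; rewrite negb_or => /andP[n1 n2].
  have [ji|ji] : (j < i) \/ (i.+1 < j) by lia.
    by have := @linear_path_meet _ _ j i.+1 x pP; move=> /(_ _ xj xi1); lia.
  by have := @linear_path_meet _ _ i j x pP; move=> /(_ _ xi xj); lia.
(* Away from position [i], [f] meets the path only in [p 0] and [p i.+1]; the
   former precedes it in the new path and the latter follows it. *)
have fpj j : j < k -> j != i -> #|f :&: p j| = (j == 0) || (j == i.+1).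
  move=> jk ji; rewrite fp //.
  have [j0|j0] := eqVneq j 0.
    rewrite (_ : _ :&: _ = [set u]) ?cards1 //; apply/setP => y.
    rewrite !inE j0; have [->|_] /= := eqVneq y u; first by rewrite u0.
    by apply/negP => /andP[/eqP-> x0]; have := xj 0; rewrite x0; lia.
  have [j1|j1] /= := eqVneq j i.+1.
    rewrite (_ : _ :&: _ = [set x]) ?cards1 //; apply/setP => y.
    rewrite !inE j1; have [->|_] /= := eqVneq y x; first by rewrite xi1 orbT.
    rewrite orbF; apply/negP => /andP[/eqP-> uy].
    by have := uj i.+1; rewrite uy; lia.
  apply/eqP; rewrite cards_eq0; apply/eqP/setP => y; rewrite !inE.
  apply/negP => /andP[/orP[]/eqP-> yj]; first by have := uj j; rewrite yj; lia.
  by have := xj j jk yj; lia.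
split=> [j jk|a b ab].
  case: ifP => // _; first by apply: pE; lia.
  by case: ifP => // _; apply: pE.
have [ai|ai] := ltnP a i; have [bi|bi] := ltnP b i.
- by rewrite setIC pI; last lia; congr nat_of_bool; lia.
- have [->|bn] := eqVneq b i.
    by rewrite setIC fpj; [congr nat_of_bool| |]; lia.
  by rewrite pI; last lia; congr nat_of_bool; lia.
- lia.
have -> : (b == i) = false by lia.
have [->|an] := eqVneq a i; first by rewrite fpj; [congr nat_of_bool| |]; lia.
by apply: pI; lia.
Qed.

(** For [u] an end vertex of a path with vertex set [S], these are the vertices
    [x] at which an edge through [u] can be used for a rotation. *)
Definition touches_only S u x := [exists f in E, f :&: S == [set u; x]].

Definition contacts S U x := #|[set u in U | touches_only S u x]|.

(** The edges that realise the contacts of [x] pairwise share only [x].  If all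
    of them meet [g] outside [S], they do so in different vertices. *)
Lemma contacts_le S U x g n : x \notin U -> x \in S ->
  #|g :\: S| <= n ->
  (forall f u, f \in E -> u \in U -> f :&: S = [set u; x] ->
     exists2 z, z \in f & z \in g :\: S) ->
  contacts S U x <= n.
Proof.
move=> xU xS gn meet; apply: leq_trans gn.
pose h u := odflt x [pick z in g :\: S |
  [exists f in E, (f :&: S == [set u; x]) && (z \in f)]].
have hP u : u \in U -> touches_only S u x -> h u \in g :\: S /\
    exists2 f, f \in E & f :&: S = [set u; x] /\ h u \in f.
  move=> uU /exists_inP[f fE /eqP fS]; rewrite /h; case: pickP => [z|].
    move=> /andP[zg /exists_inP[f' f'E /andP[/eqP f'S zf']]].
    by split=> //; exists f'.
  have [z zf zg] := meet _ _ fE uU fS.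
  move=> /(_ z); rewrite zg /= => /exists_inP[]; exists f => //.
  by rewrite fS eqxx zf.
rewrite /contacts -(@card_in_imset _ _ h).
  apply/subset_leq_card/subsetP => _ /imsetP[u + ->].
  by rewrite inE => /andP[uU uR]; case: (hP u uU uR).
move=> u w; rewrite !inE => /andP[uU uR] /andP[wU wR] huw.
have [+ [f fE [fS uf]]] := hP u uU uR; rewrite inE => /andP[hS _].
have [_ [f' f'E [f'S wf']]] := hP w wU wR.
have xf e t : e :&: S = [set t; x] -> x \in e.
  by move=> /setP/(_ x); rewrite !inE eqxx orbT => /andP[].
have fff' : f = f'.
  apply: (@edge_unique f f' x (h u)) => //.
  - by apply: contraNneq hS => <-.
  - exact: xf fS.
  - exact: xf f'S.
  by rewrite huw.
have: u \in [set w; x] by rewrite -f'S -fff' fS !inE eqxx.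
by rewrite !inE => /orP[/eqP//|/eqP ux]; rewrite -ux uU in xU.
Qed.

Lemma leq_contacts S U x : contacts S U x <= #|U|.
Proof. by apply/subset_leq_card/subsetP => u; rewrite inE => /andP[]. Qed.

Lemma leq_sum_contacts S U (A : {set T}) :
  \sum_(x in A) contacts S U x <= #|A| * #|U|.
Proof. by rewrite -sum_nat_const; apply: leq_sum => x _; exact: leq_contacts. Qed.

Lemma card_outside S g v y : v != y -> g \in E -> g :&: S = [set v; y] ->
  #|g :\: S| = r - 2.
Proof.
move=> vy gE gS; have := cardsID S g.
by rewrite gS cards2 vy (uniE gE) => <-; rewrite addKn.
Qed.

(** If neither summand vanishes, an edge of one kind has to be met by all edges
    of the other kind, in its r-2 vertices outside [S]; hence [x] and each [y]
    have at most r-2 contacts instead of r-1.  If one summand vanishes, the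
    other one is small enough because r >= 3. *)
Lemma contacts_conflict S U W (I : {set T}) x : 2 < r ->
  #|U| = r.-1 -> #|W| = r.-1 -> #|I| = r - 2 ->
  x \in S -> I \subset S -> x \notin U -> x \notin W ->
  x \notin I -> [disjoint U & W] -> [disjoint I & U] -> [disjoint I & W] ->
  (forall f g u w y, f \in E -> g \in E -> u \in U -> w \in W -> y \in I ->
     f :&: S = [set u; x] -> g :&: S = [set w; y] -> f :&: g != set0) ->
  contacts S U x + \sum_(y in I) contacts S W y <= r.-1 * (r - 2).
Proof.
move=> r2 cU cW cI xS IS xU xW xI dUW dIU dIW meet.
have ne_disj (A B : {set T}) a b : [disjoint A & B] ->
    a \in A -> b \in B -> a != b.
  by move=> dAB aA bB; apply: contraTneq aA => ->; rewrite (disjointFl dAB bB).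
have out f g u w y : f \in E -> g \in E -> u \in U -> w \in W -> y \in I ->
    f :&: S = [set u; x] -> g :&: S = [set w; y] ->
    exists z, [/\ z \in f, z \in g & z \notin S].
  move=> fE gE uU wW yI fS gS.
  have /set0Pn[z /setIP[zf zg]] := meet _ _ _ _ _ fE gE uU wW yI fS gS.
  exists z; split=> //; apply/negP => zS.
  have: z \in [set u; x] by rewrite -fS inE zf.
  have: z \in [set w; y] by rewrite -gS inE zg.
  have uw := ne_disj _ _ _ _ dUW uU wW; have yu := ne_disj _ _ _ _ dIU yI uU.
  case/set2P=> -> /set2P[]; move/eqP.
  - by rewrite eq_sym (negbTE uw).
  - by apply/negP; apply: contraNneq xW => <-.
  - by rewrite (negbTE yu).
  - by apply/negP; apply: contraNneq xI => <-.
have [a0|] := posnP (contacts S U x).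
  rewrite a0; apply: leq_trans (leq_sum_contacts _ _ _) _.
  by rewrite cI cW mulnC.
rewrite card_gt0 => /set0Pn[u]; rewrite inE => /andP[uU /exists_inP[f fE /eqP fS]].
have ux : u != x by apply: contraNneq xU => <-.
have bW y : y \in I -> contacts S W y <= r - 2.
  move=> yI; apply: (@contacts_le _ _ _ f).
  - by rewrite (disjointFr dIW yI).
  - exact: (subsetP IS).
  - by rewrite (card_outside ux fE fS).
  move=> g w gE wW gS; have [z [zf zg zS]] := out _ _ _ _ _ fE gE uU wW yI fS gS.
  by exists z => //; rewrite inE zf zS.
have bI : \sum_(y in I) contacts S W y <= (r - 2) * (r - 2).
  by rewrite -[X in _ <= X * _]cI -sum_nat_const; apply: leq_sum.
have [b0|] := posnP (\sum_(y in I) contacts S W y).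
  rewrite b0 addn0; apply: leq_trans (leq_contacts _ _ _) _.
  by rewrite cU leq_pmulr // subn_gt0.
rewrite lt0n sum_nat_eq0 negb_forall => /existsP[y]; rewrite negb_imply.
move=> /andP[yI]; rewrite -lt0n card_gt0 => /set0Pn[w]; rewrite inE.
move=> /andP[wW /exists_inP[g gE /eqP gS]].
have wy : w != y by rewrite eq_sym (ne_disj _ _ _ _ dIW).
have aU : contacts S U x <= r - 2.
  apply: (@contacts_le _ _ _ g) => //; first by rewrite (card_outside wy gE gS).
  move=> f' u' f'E u'U f'S.
  have [z [zf zg zS]] := out _ _ _ _ _ f'E gE u'U wW yI f'S gS.
  by exists z => //; rewrite inE zg zS.
by rewrite -subn1 -(subnSK (ltnW r2)) mulSn leq_add.
Qed.

Lemma card_step k p i j : linear_path k p -> i < k -> j < k ->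
  (i == j.+1) || (j == i.+1) -> #|p i :\: p j| = r.-1.
Proof.
move=> [pE pI] ik jk ij.
have := cardsID (p j) (p i); rewrite (uniE (pE _ ik)).
have -> : #|p i :&: p j| = 1.
  have [/eqP ij'|/eqP ij'] := orP ij; last by rewrite pI; lia.
  by rewrite setIC pI; lia.
by lia.
Qed.

Section LongestPath.
Variables (k : nat) (p : nat -> {set T}).
Hypothesis k2 : 1 < k.
Hypothesis pP : linear_path k p.
Hypothesis p_longest : forall q, ~ linear_path k.+1 q.

(** Otherwise [f] would prolong the path. *)
Lemma end_edge_touches u f : u \in p 0 :\: p 1 -> f \in E -> u \in f ->
  f != p 0 -> f :&: (span k p :\: p 0) != set0.
Proof.
move=> uU fE uf f0; apply/negP => /eqP fV.
have p0E : p 0 \in E by apply: (proj1 pP); lia.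
have /setDP[u0 _] := uU.
apply: (p_longest (q := fun i => if i < k then flip k p i else f)).
apply: linear_path_rcons => //; first by lia.
- exact: linear_path_flip.
- rewrite /flip subnn; apply/eqP; rewrite eqn_leq linE 1?eq_sym //= card_gt0.
  by apply/set0Pn; exists u; rewrite inE u0.
move=> i ik; apply/setP => x; rewrite !inE /flip; apply/negP => /andP[xi xf].
have [x0|x0] := boolP (x \in p 0).
  have xu : x = u.
    apply: contraNeq f0 => xu; apply/eqP.
    exact: (edge_unique fE p0E xu).
  have i1 : k.-1 - i = 1.
    by apply: (@linear_path_meet k p 0 _ x) => //; lia.
  by move: uU; rewrite -xu inE -i1 xi.
have : x \in f :&: (span k p :\: p 0).
  by rewrite !inE xf x0; apply/spanP; exists (k.-1 - i) => //; lia.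
by rewrite fV inE.
Qed.

(** The edges through [u] other than [p 0] cover disjoint nonempty parts of
    [span k p :\: p 0].  An edge covering a single vertex [x] of it is counted
    once for covering [x] and a second time by [touches_only]. *)
Lemma end_degree_le u : u \in p 0 :\: p 1 ->
  2 * #|[set f in E | u \in f]| <=
    2 + \sum_(x in span k p :\: p 0) (1 + touches_only (span k p) u x).
Proof.
move=> uU; have /setDP[u0 _] := uU.
have p0E : p 0 \in E by apply: (proj1 pP); lia.
rewrite (cardsD1 (p 0)) inE p0E u0 mulnDr leq_add2l.
set D := _ :\ _; set S := span k p; set V := S :\: p 0.
have DP f : f \in D -> [/\ f \in E, u \in f & f != p 0].
  by rewrite !inE => /andP[? /andP[]].
have uS : u \in S by apply/spanP; exists 0 => //; lia.
apply: (@leq_trans (\sum_(f in D) (#|f :&: V| +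
                       \sum_(x in V) (f :&: S == [set u; x])))).
  rewrite mulnC -sum_nat_const; apply: leq_sum => f /DP[fE uf f0].
  have := end_edge_touches uU fE uf f0.
  have [gt1 _|le1 /set0Pn[x]] := ltnP 1 #|f :&: V|; first by rewrite ltn_addr.
  rewrite !inE => /andP[xf /andP[x0 xS]].
  have xV : x \in V by rewrite inE x0.
  have fV : f :&: V = [set x].
    apply/esym/eqP; rewrite eqEcard cards1 le1 andbT.
    by apply/subsetP => z /set1P->; rewrite inE xf.
  rewrite fV cards1 add1n ltnS (bigD1 x) //= (_ : _ == _) //.
  apply/eqP/setP => z; rewrite !inE.
  have [z0|z0] := boolP (z \in p 0); last first.
    have /setP/(_ z) := fV; rewrite !inE z0 /= => ->.
    by rewrite (_ : (z == u) = false) //; apply: contraNF z0 => /eqP->.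
  have -> : (z == x) = false by apply: contraNF x0 => /eqP<-.
  rewrite orbF; apply/andP/eqP => [[zf _]|->]; last by [].
  by apply: contraNeq f0 => zu; apply/eqP; exact: (edge_unique fE p0E zu).
rewrite big_split /=.
under eq_bigr do rewrite -sum1_card big_mkcond /=.
have -> : \sum_(f in D) \sum_x (if x \in f :&: V then 1 else 0)
        = \sum_(f in D) \sum_(x in V) (x \in f).
  apply: eq_bigr => f _; rewrite [RHS]big_mkcond; apply: eq_bigr => x _.
  by rewrite inE; case: (x \in f); case: (x \in V).
rewrite exchange_big [X in _ + X]exchange_big -big_split; apply: leq_sum => x.
rewrite inE => /andP[x0 xS]; have ux : u != x by apply: contraNneq x0 => <-.
(* Linearity: the edges of [D] share [u], so only one of them contains [x]. *)
have uniq1 (Q : pred {set T}) : (forall f, f \in D -> Q f -> x \in f) ->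
    \sum_(f in D) Q f <= [exists f in D, Q f].
  move=> Qx; have [/exists_inP[f fD Qf]|no] := boolP [exists f in D, Q f].
    rewrite (bigD1 f) //= Qf big1 // => g /andP[gD gf].
    apply/eqP; rewrite eqb0; apply: contra gf => Qg.
    have [fE uf _] := DP _ fD; have [gE ug _] := DP _ gD.
    by apply/eqP; apply: (edge_unique gE fE ux) => //; apply: Qx.
  rewrite big1 // => f fD; apply/eqP; rewrite eqb0.
  by apply: contra no => Qf; apply/exists_inP; exists f.
apply: leq_add; first by apply: leq_trans (uniq1 _ _) (leq_b1 _).
apply: leq_trans (uniq1 _ _) _.
  by move=> f fD /eqP/setP/(_ x); rewrite !inE eqxx orbT => /andP[].
case: exists_inP => // -[f /DP[fE _ _] fS].
by rewrite (_ : touches_only _ _ _) //; apply/exists_inP; exists f.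
Qed.

(** Summation of the previous bound over all end vertices.  The vertices
    outside [p 0] are distributed over the sets [p i :\: p i.-1], each of which
    has r-1 elements. *)
Lemma end_degrees_le d :
  (forall u, u \in p 0 -> d <= #|[set f in E | u \in f]|) ->
  r.-1 * (2 * d) <= r.-1 * 2 + k.-1 * r.-1 ^ 2 +
    \sum_(1 <= i < k) \sum_(x in p i :\: p i.-1)
       contacts (span k p) (p 0 :\: p 1) x.
Proof.
move=> dmin; set S := span k p; set U := p 0 :\: p 1.
have cU : #|U| = r.-1 by apply: (card_step pP); lia.
have cover x : x \in S :\: p 0 -> exists2 i, 1 <= i < k & x \in p i :\: p i.-1.
  rewrite inE => /andP[x0 /spanP ex].
  have ex' : exists i, (i < k) && (x \in p i) by case: ex => i; exists i; apply/andP.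
  case: (ex_minnP ex') => i /andP[ik xi] imin.
  have i0 : 0 < i by case: i xi {ik imin} => // xi; rewrite xi in x0.
  exists i; rewrite ?i0 // inE xi andbT; apply/negP => xi1.
  by have := imin i.-1; rewrite xi1 andbT; lia.
have H u : u \in U -> 2 * d <= 2 + \sum_(1 <= i < k)
     \sum_(x in p i :\: p i.-1) (1 + touches_only S u x).
  move=> uU; apply: leq_trans (leq_trans (end_degree_le uU) _).
    by rewrite leq_mul2l dmin //; have /setDP[] := uU.
  by rewrite leq_add2l; apply: leq_sum_cover.
rewrite -{1}cU -sum_nat_const; apply: leq_trans (leq_sum _ H) _.
rewrite big_split sum_nat_const cU /= -addnA leq_add2l.
rewrite exchange_big /=.
have -> : k.-1 * r.-1 ^ 2 = \sum_(1 <= i < k) r.-1 ^ 2.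
  by rewrite sum_nat_const_nat subn1.
rewrite -big_split /= big_nat [X in _ <= X]big_nat; apply: leq_sum => i ik.
rewrite exchange_big /=; under eq_bigr do rewrite big_split /=.
rewrite big_split /= sum1_card sum_nat_const cU (card_step pP); try lia.
rewrite leq_add2l; apply: leq_sum => x _.
rewrite /contacts -sum1_card big_mkcond [X in _ <= X]big_mkcond.
by apply: leq_sum => u _; rewrite inE; case: (u \in U); case: touches_only.
Qed.

(** An edge [g] from [w] to a private vertex [y] of [p i] extends the path
    obtained by rotating along [f], unless [f] and [g] meet. *)
Lemma path_conflict i : 2 < r -> 0 < i -> i.+1 < k ->
  \sum_(x in (p i :\: p i.-1) :&: p i.+1) contacts (span k p) (p 0 :\: p 1) x +
  \sum_(y in (p i :\: p i.-1) :\: p i.+1)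
     contacts (span k p) (p k.-1 :\: p k.-2) y <= r.-1 * (r - 2).
Proof.
move=> r2 i0 ik; set S := span k p; set U := p 0 :\: p 1.
set W := p k.-1 :\: p k.-2; set I := _ :\: p i.+1.
have [pE pI] := pP.
have : #|p i :&: p i.+1| == 1 by rewrite pI ?eqxx; lia.
move=> /cards1P[x xJ].
have /setIP[xi xi1] : x \in p i :&: p i.+1 by rewrite xJ inE.
have sub j : j < k -> p j \subset S.
  by move=> jk; apply/subsetP => y yj; apply/spanP; exists j.
have adj := linear_path_meet pP.
have xJ' : (p i :\: p i.-1) :&: p i.+1 = [set x].
  rewrite -xJ; apply/setP => y; rewrite !inE.
  have [yi1|_] := boolP (y \in p i.-1) => //=.
  have [yi|_] //= := boolP (y \in p i.+1); last by rewrite andbF.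
  by have := adj i.-1 i.+1 y _ yi1 yi; lia.
rewrite xJ' big_set1.
have UP u : u \in U -> forall j, 0 < j < k -> u \notin p j.
  move=> /setDP[u0 u1] j jk; apply: contra u1 => uj.
  by rewrite -(adj _ _ _ jk u0 uj).
have WP w : w \in W -> forall j, j < k.-1 -> w \notin p j.
  move=> /setDP[w0 w1] j jk; apply: contra w1 => wj.
  have e := adj j k.-1 w _ wj w0; rewrite (_ : k.-2 = j) //.
  by rewrite e //; lia.
have IP y : y \in I -> y \in p i /\ forall j, j < k -> y \in p j -> j = i.
  rewrite !inE => /andP[y1 /andP[y2 yi]]; split=> // j jk yj.
  apply/eqP; apply: contraT => ne.
  have [ji|ij] : (j < i) \/ (i < j) by lia.
    have e := adj j i y _ yj yi; move: y2; rewrite (_ : i.-1 = j) ?yj //.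
    by rewrite e //; lia.
  by have e := adj i j y _ yi yj; move: y1; rewrite -e ?yj //; lia.
have cI : #|I| = r - 2.
  have cpi : #|p i :\: p i.-1| = r.-1 by apply: (card_step pP); lia.
  have := cardsID (p i.+1) (p i :\: p i.-1).
  by rewrite cpi -/I xJ' cards1; lia.
apply: contacts_conflict => //.
- by apply: (card_step pP); lia.
- by apply: (card_step pP); lia.
- by apply: (subsetP (sub i _)); lia.
- by apply/subsetP => y /IP[yi _]; apply: (subsetP (sub i _)) => //; lia.
- by apply/negP => /UP/(_ i); rewrite xi; lia.
- by apply/negP => /WP/(_ i); rewrite xi; lia.
- by apply/negP => /IP[_ /(_ i.+1)]; rewrite xi1; lia.
- apply/pred0P => z /=; apply/negP => /andP[/UP/(_ k.-1) zU /setDP[zk _]].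
  by rewrite zk in zU; lia.
- apply/pred0P => z /=; apply/negP => /andP[/IP[zi _] /UP/(_ i)].
  by rewrite zi; lia.
- apply/pred0P => z /=; apply/negP => /andP[/IP[zi _] /WP/(_ i)].
  by rewrite zi; lia.
move=> f g u w y fE gE uU wW yI fS gS; apply/negP => /eqP fg0.
have [yi yI'] := IP _ yI.
have rP := linear_path_rotate pP i0 ik fE fS uU (introT setIP (conj xi xi1)).
have gp j : j < k -> g :&: p j = [set w; y] :&: p j.
  by move=> jk; rewrite -gS -setIA; congr (_ :&: _); apply/esym/setIidPr/sub.
have /setDP[wk _] := wW.
apply: p_longest; apply: linear_path_rcons rP gE _ _; first by lia.
- have -> : (k.-1 < i) = false by lia.
  have -> : (k.-1 == i) = false by lia.
  rewrite setIC gp; last by lia.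
  rewrite (_ : _ :&: _ = [set w]) ?cards1 //; apply/setP => z; rewrite !inE.
  have [->|_] /= := eqVneq z w; first by rewrite wk.
  by apply/negP => /andP[/eqP-> /yI']; lia.
have gp0 j : j < k.-1 -> j != i -> p j :&: g = set0.
  move=> jk ji; rewrite setIC gp; last by lia.
  apply/setP => z; rewrite !inE; apply/negP => /andP[/orP[]/eqP-> zj].
    by have := WP w wW j jk; rewrite zj.
  by have := yI' j _ zj; lia.
by move=> j jk; case: ltnP => ji; [|case: eqVneq => // ne]; apply: gp0; lia.
Qed.

End LongestPath.

(** The two set differences contain the private vertices of [p i] together with
    the vertex shared with the next, respectively the previous, edge.
    Exchanging the private parts of the two sums gives one instance of
    [path_conflict] for the path and one for its reversal. *)
Lemma inner_conflict k p i : 2 < r -> 1 < k -> linear_path k p ->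
  (forall q, ~ linear_path k.+1 q) -> 0 < i -> i.+1 < k ->
  \sum_(x in p i :\: p i.-1) contacts (span k p) (p 0 :\: p 1) x +
  \sum_(x in p i :\: p i.+1) contacts (span k p) (p k.-1 :\: p k.-2) x
    <= 2 * (r.-1 * (r - 2)).
Proof.
move=> r2 k2 pP longest i0 ik.
have H := path_conflict k2 pP longest r2 i0 ik.
have := path_conflict (i := k.-1 - i) k2 (linear_path_flip pP) longest r2.
rewrite span_flip /flip subn0 subn1 subnn.
have -> : k.-1 - k.-2 = 1 by lia.
have -> : k.-1 - (k.-1 - i) = i by lia.
have -> : k.-1 - (k.-1 - i).-1 = i.+1 by lia.
have -> : k.-1 - (k.-1 - i).+1 = i.-1 by lia.
have g1 : 0 < k.-1 - i by lia.
have g2 : (k.-1 - i).+1 < k by lia.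
move=> /(_ g1 g2) H'.
rewrite (big_setID (p i.+1)) [X in _ + X](big_setID (p i.-1)) /=.
by move: H H'; rewrite !setDDl [p i.+1 :|: _]setUC; lia.
Qed.

(** The degree sums over both ends exceed what the inner conflicts allow.  The
    absence of paths, rather than their existence, is carried along so that the
    step can be iterated downwards from the wanted length. *)
Lemma no_shorter_path k d : 2 < r -> 1 < k ->
  (forall e u, e \in E -> u \in e -> d <= #|[set f in E | u \in f]|) ->
  (2 * r - 3) * k.+1 < 2 * d ->
  (forall q, ~ linear_path k.+1 q) -> forall p, ~ linear_path k p.
Proof.
move=> r2 k2 dmin dk longest p pP.
have [m km] : exists m, k = m.+2 by exists k.-2; lia.
subst k; have pE i : i < m.+2 -> p i \in E by case: pP => + _; apply.
have cs i j := @card_step _ _ i j pP.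
have inner i := @inner_conflict _ _ i r2 k2 pP longest.
have := end_degrees_le (d := d) k2 pP longest.
move=> /(_ (fun u => dmin _ u (pE 0 isT))).
have := end_degrees_le (d := d) k2 (linear_path_flip pP) longest.
rewrite span_flip /flip subn0 subn1 /=.
move=> /(_ (fun u => dmin _ u (pE m.+1 (leqnn _)))).
move: inner => /=.
set S := span _ p; set U := p 0 :\: p 1; set W := p m.+1 :\: p m => inner.
rewrite !(@big_nat_recr _ _ _ m.+1 1) //= subnn subSnn -/U -/W.
rewrite (_ : \sum_(1 <= i < m.+1) _ =
             \sum_(1 <= i < m.+1) \sum_(x in p i :\: p i.+1) contacts S W x).
  have {inner} inner : \sum_(1 <= i < m.+1)
      (\sum_(x in p i :\: p i.-1) contacts S U x +
       \sum_(x in p i :\: p i.+1) contacts S W x)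
       <= m * (2 * (r.-1 * (r - 2))).
    rewrite -[X in _ <= X * _](subn1 m.+1) -sum_nat_const_nat.
    rewrite big_nat [X in _ <= X]big_nat.
    by apply: leq_sum => i /andP[i0 im]; apply: inner; lia.
  rewrite big_split /= in inner.
  have cU : #|U| = r.-1 by apply: cs.
  have cW : #|W| = r.-1 by apply: cs; rewrite ?eqxx ?orbT.
  have lW : \sum_(x in U) contacts S W x <= r.-1 * r.-1.
    by apply: leq_trans (leq_sum_contacts _ _ _) _; rewrite cU cW.
  have lU : \sum_(x in W) contacts S U x <= r.-1 * r.-1.
    by apply: leq_trans (leq_sum_contacts _ _ _) _; rewrite cU cW.
  move=> HW HU; apply/negP: dk; rewrite -leqNgt.
  have -> : 2 * r - 3 = 2 * (r - 2) + 1 by lia.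
  have rE : r.-1 = (r - 2).+1 by rewrite -subn1 subnSK // ltnW.
  rewrite rE in inner lW lU HW HU.
  by apply: path_count_arith inner lU lW HU HW; rewrite subn_gt0.
rewrite big_nat_rev big_nat [RHS]big_nat; apply: eq_bigr => i im.
have -> : m.+1 - (1 + m.+1 - i.+1) = i by lia.
by have -> : m.+1 - (1 + m.+1 - i.+1).-1 = i.+1 by lia.
Qed.

(** Existence is stated as a double negation because [linear_path] is not a
    boolean predicate; this suffices for a decidable conclusion. *)
Lemma min_degree_path l d e : 2 < r -> 1 < l -> e \in E ->
  (forall e u, e \in E -> u \in e -> d <= #|[set f in E | u \in f]|) ->
  (2 * r - 3) * l < 2 * d -> ~ forall p, ~ linear_path l p.
Proof.
move=> r2 l2 eE dmin dl nol.
have d2 : 1 < d by nia.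
have no2 : forall p, ~ linear_path 2 p.
  have H j : j < l.-1 -> forall p, ~ linear_path (l - j) p.
    elim: j => [|j IH] jl; first by rewrite subn0.
    apply: (no_shorter_path (d := d)) => //; first by lia.
      by apply: leq_ltn_trans dl; rewrite leq_mul2l; apply/orP; right; lia.
    by rewrite subnSK; [apply: IH; lia | lia].
  by have := H l.-2; rewrite (_ : l - l.-2 = 2); [apply|]; lia.
have /card_gt0P[u ue] : 0 < #|e| by rewrite uniE //; lia.
have: 0 < #|[set f in E | u \in f] :\ e|.
  by have := dmin _ _ eE ue; rewrite (cardsD1 e) inE eE ue; lia.
case/card_gt0P => f; rewrite !inE => /andP[fe /andP[fE uf]].
apply: (no2 (fun i => if i == 0 then e else f)); split=> [i _|i j ij].
  by case: ifP.
have -> : i = 0 by lia.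
have -> /= : j = 1 by lia.
apply/eqP; rewrite eqn_leq linE 1?eq_sym //= card_gt0.
by apply/set0Pn; exists u; rewrite inE ue.
Qed.

End LinearPaths.

(** * Passing to a subfamily of large minimum degree *)

(** In a smallest vertex set [W] spanning more than c|W|/2 edges, deleting a
    vertex must destroy more than c/2 edges. *)
Lemma dense_core (T : finType) (E : {set {set T}}) c : c * #|T| < 2 * #|E| ->
  exists2 F : {set {set T}}, F \subset E &
    F != set0 /\ forall e u, e \in F -> u \in e ->
                   c < 2 * #|[set f in F | u \in f]|.
Proof.
move=> dense; pose on (W : {set T}) := [set e in E | e \subset W].
have dT : c * #|[set: T]| < 2 * #|on setT|.
  rewrite cardsT (_ : on setT = E) //.
  by apply/setP => e; rewrite inE subsetT andbT.
case: (@arg_minnP _ setT (fun W => c * #|W| < 2 * #|on W|) (fun W => #|W|) dT).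
move=> W dW Wmin; exists (on W).
  by apply/subsetP => e; rewrite inE => /andP[].
split=> [|e u]; first by apply: contraTneq dW => ->; rewrite cards0; lia.
rewrite inE => /andP[_ /subsetP eW] /eW uW.
have WD := cardsD1 u W; rewrite uW in WD.
have : ~~ (c * #|W :\ u| < 2 * #|on (W :\ u)|).
  by apply/negP => /Wmin; lia.
have -> : #|on (W :\ u)| = #|on W| - #|[set f in on W | u \in f]|.
  have := cardsID [set f : {set T} | u \in f] (on W).
  rewrite (_ : _ :&: _ = [set f in on W | u \in f]) => [|]; last first.
    by apply/setP => f; rewrite !inE.
  rewrite (_ : _ :\: _ = on (W :\ u)) => [<-|]; first by rewrite addKn.
  by apply/setP => f; rewrite !inE subsetD1; case: (u \in f); rewrite ?andbF ?andbT.
by move: dW; rewrite WD; nia.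
Qed.

(** * From edges in path position to a copy of the path *)

Lemma fiberwise_injection (C T1 T2 : finType) (s1 : T1 -> C) (s2 : T2 -> C) :
  (forall c, #|[set x | s1 x == c]| <= #|[set y | s2 y == c]|) ->
  exists2 f : T1 -> T2, injective f & forall x, s2 (f x) = s1 x.
Proof.
move=> le12.
have in1 x : x \in [set z | s1 z == s1 x] by rewrite inE.
pose f x := enum_val (widen_ord (le12 (s1 x)) (enum_rank_in (in1 x) x)).
have fs x : s2 (f x) = s1 x.
  by have := enum_valP (widen_ord (le12 (s1 x)) (enum_rank_in (in1 x) x));
     rewrite inE => /eqP.
exists f => // x y fxy; have sxy : s1 x = s1 y by rewrite -!fs fxy.
move: fxy; rewrite /f; move: (in1 x) (in1 y); rewrite -sxy => x1 y1.
move=> /enum_val_inj /(congr1 val) /= /val_inj.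
move=> /(congr1 enum_val); rewrite !enum_rankK_in // inE ?sxy //.
Qed.

Lemma sub_copy (F : hypergraph) (T : finType) (E' E : {set {set T}}) :
  E' \subset E -> contains_copy F (Hypergraph E') ->
  contains_copy F (Hypergraph E).
Proof.
move=> /subsetP sub /existsP[f /andP[fI /forall_inP fE]].
apply/existsP; exists f; rewrite fI; apply/forall_inP => e /fE; exact: sub.
Qed.

(** When no vertex lies on three of the sets [a i], the class of vertices with
    incidence set [A] is determined in size by the intersections of pairs: it
    is empty for #|A| > 2, an intersection for #|A| = 2, and what remains of
    [a i] for A = [set i]. *)
Section Incidence.
Variables (l : nat) (T : finType) (a : 'I_l -> {set T}).
Hypothesis no_triple : forall i j m, i != j -> j != m -> i != m ->
  a i :&: a j :&: a m = set0.

Definition incidence x := [set i | x \in a i].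

Definition fiber A := [set x | incidence x == A].

Lemma fiber_triple (A : {set 'I_l}) i j m : i \in A -> j \in A -> m \in A ->
  i != j -> j != m -> i != m -> fiber A = set0.
Proof.
move=> iA jA mA ij jm im; apply/setP => x; rewrite !inE; apply/eqP => xA.
move: iA jA mA; rewrite -xA !inE => xi xj xm.
by have /setP/(_ x) := no_triple ij jm im; rewrite !inE xi xj xm.
Qed.

Lemma fiber_pair i j : i != j -> fiber [set i; j] = a i :&: a j.
Proof.
move=> ij; apply/setP => x; rewrite !inE; apply/eqP/andP => [xA|[xi xj]].
  by split; [have := set21 i j|have := set22 i j]; rewrite -xA inE.
apply/setP => m; rewrite !inE; have [->|mi] := eqVneq m i; first by rewrite xi.
have [->|mj] /= := eqVneq m j; first by rewrite xj.
apply/negP => xm; have jm : j != m by rewrite eq_sym.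
have im : i != m by rewrite eq_sym.
by have /setP/(_ x) := no_triple ij jm im; rewrite !inE xi xj xm.
Qed.

Lemma card_fibers i : #|a i| = \sum_(A : {set 'I_l} | i \in A) #|fiber A|.
Proof.
rewrite -sum1_card (partition_big incidence (fun A => i \in A)) /=.
  apply: eq_bigr => A iA; rewrite -sum1_card; apply: eq_bigl => x.
  rewrite [RHS]inE; case: eqP => [xA|]; rewrite ?andbF // andbT.
  by move: iA; rewrite -xA inE.
by move=> x xi; rewrite inE.
Qed.

End Incidence.

Lemma eq_card_fiber (l : nat) (T1 T2 : finType)
    (a : 'I_l -> {set T1}) (b : 'I_l -> {set T2}) (A : {set 'I_l}) :
  (forall i j m, i != j -> j != m -> i != m -> a i :&: a j :&: a m = set0) ->
  (forall i j m, i != j -> j != m -> i != m -> b i :&: b j :&: b m = set0) ->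
  (forall i j, #|a i :&: a j| = #|b i :&: b j|) ->
  A != set0 -> #|fiber a A| = #|fiber b A|.
Proof.
move=> a3 b3 ab /set0Pn[i iA].
have big (B : {set 'I_l}) j : i \in B -> j \in B -> i != j ->
    #|fiber a B| = #|fiber b B|.
  move=> iB jB ij; have [->|] := eqVneq B [set i; j].
    by rewrite !fiber_pair.
  rewrite eqEsubset subUset !sub1set iB jB !andbT; case/subsetPn => m mB.
  rewrite !inE negb_or => /andP[mi mj].
  rewrite !(@fiber_triple _ _ _ _ B i j m) ?cards0 //;
    by rewrite eq_sym.
have [->|] := eqVneq A [set i]; last first.
  rewrite eqEsubset sub1set iA andbT; case/subsetPn => j jA.
  by rewrite inE eq_sym => ij; apply: (big A j).
have rest : \sum_(B : {set 'I_l} | (i \in B) && (B != [set i])) #|fiber a B| =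
            \sum_(B : {set 'I_l} | (i \in B) && (B != [set i])) #|fiber b B|.
  apply: eq_bigr => B /andP[iB]; rewrite eqEsubset sub1set iB andbT.
  by case/subsetPn => j jB; rewrite inE eq_sym => ij; apply: (big B j).
have := ab i i; rewrite !setIid !card_fibers.
rewrite (bigD1 [set i]) ?set11 // [RHS](bigD1 [set i]) ?set11 //= rest.
by move/addIn.
Qed.

Lemma path_no_triple l (T : finType) (a : 'I_l -> {set T}) :
  (forall i j : 'I_l, i != j -> i.+1 != j :> nat -> j.+1 != i :> nat ->
     a i :&: a j = set0) ->
  forall i j m, i != j -> j != m -> i != m -> a i :&: a j :&: a m = set0.
Proof.
move=> a0 i j m ij jm im; have := (ij, jm, im).
rewrite -!val_eqE /= => -[[nij njm] nim].
have [[h1 h2]|[[h1 h2]|[h1 h2]]] :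
  (i.+1 != j :> nat /\ j.+1 != i :> nat) \/
  ((j.+1 != m :> nat /\ m.+1 != j :> nat) \/
   (i.+1 != m :> nat /\ m.+1 != i :> nat)) by lia.
- by rewrite a0 ?set0I.
- by rewrite -setIA a0 ?setI0.
by rewrite setIAC a0 ?set0I.
Qed.

Lemma linear_path_copy r l (T : finType) (E : {set {set T}}) p P :
  (forall e, e \in E -> #|e| = r) -> linear_path E l p ->
  is_linear_path r l P -> contains_copy P (Hypergraph E).
Proof.
move=> uniE [pE pI] [/forall_inP/= uniP [e [eP e1 e0 eS]]].
have eE i : e i \in edges P by rewrite eP; apply/imsetP; exists i.
pose b (i : 'I_l) := p i.
have bcard (i j : 'I_l) : #|b i :&: b j| =
    if i == j then r else (i.+1 == j :> nat) || (j.+1 == i :> nat).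
  case: eqVneq => [->|ij]; first by rewrite setIid uniE // pE.
  have [lt|lt] : i < j \/ j < i by move: ij; rewrite -val_eqE /=; lia.
    by rewrite pI ?lt ?ltn_ord //; congr nat_of_bool; lia.
  by rewrite setIC pI ?lt ?ltn_ord //; congr nat_of_bool; lia.
have e0' (i j : 'I_l) : i != j -> i.+1 != j :> nat -> j.+1 != i :> nat ->
    e i :&: e j = set0.
  by move=> ij h1 h2; apply: e0 => //; lia.
have ecard i j : #|e i :&: e j| = #|b i :&: b j|.
  rewrite bcard; case: eqVneq => [->|ij].
    by rewrite setIid; apply/eqP/uniP.
  have [adj|] := boolP (_ || _); first by apply: e1; lia.
  by rewrite negb_or => /andP[h1 h2]; rewrite e0' ?cards0.
have b0 (i j : 'I_l) : i != j -> i.+1 != j :> nat -> j.+1 != i :> nat ->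
    b i :&: b j = set0.
  move=> ij h1 h2; apply/eqP; rewrite -cards_eq0 bcard.
  by rewrite (negbTE ij) (negbTE h1) (negbTE h2).
have e3 := path_no_triple e0'; have b3 := path_no_triple b0.
have [f fI fe] : exists2 f, injective f &
    forall x, incidence b (f x) = incidence e x.
  apply: fiberwise_injection => A; have [->|A0] := eqVneq A set0.
    rewrite (_ : [set x | _] = set0) ?cards0 //; apply/setP => x; rewrite !inE.
    have: x \in \bigcup_(i < l) e i by rewrite eS inE.
    by case/bigcupP => i _ xi; apply/eqP => /setP/(_ i); rewrite !inE xi.
  by rewrite (eq_card_fiber e3 b3 ecard A0).
apply/existsP; exists (finfun f); apply/andP; split.
  by apply/injectiveP => x y; rewrite !ffunE => /fI.
apply/forall_inP => _ /[!eP] /imsetP[i _ ->].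
suff -> : finfun f @: e i = b i by apply: pE.
apply/eqP; rewrite eqEcard card_imset; last first.
  by move=> x y; rewrite !ffunE => /fI.
apply/andP; split.
  apply/subsetP => _ /imsetP[x xi ->]; rewrite ffunE.
  by have /setP/(_ i) := fe x; rewrite !inE xi.
by rewrite -(setIid (b i)) -ecard setIid.
Qed.

Theorem theorem1p1 (r l n : nat) (P : hypergraph)
  (hr : 3 <= r) (hl : 4 <= l) (hn : 0 < n) (hP : is_linear_path r l P) :
  ((ex_lin r n P)%:R <= (2 * r%:R - 3) * l%:R / 2 * n%:R :> rat)%R.
Proof.
have bound : ex_lin r n P <= ((2 * r - 3) * l * n) %/ 2.
  apply/bigmax_leqP => E /and3P[/forall_inP/= uE /forall_inP/= lE freeE].
  rewrite leq_divRL // leqNgt mulnC; apply: contra freeE => dense.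
  have [|F /subsetP FE [/set0Pn[e eF] degF]] := @dense_core _ E ((2 * r - 3) * l).
    by rewrite card_ord mulnC [2 * #|E|]mulnC.
  have uF f : f \in F -> #|f| = r by move=> /FE/uE/eqP.
  have lF f g : f \in F -> g \in F -> f != g -> #|f :&: g| <= 1.
    by move=> /FE fE /FE gE; have /forall_inP/(_ g gE)/implyP := lE f fE.
  apply: contraT => noP; exfalso.
  apply: (@min_degree_path _ F r uF lF l ((2 * r - 3) * l)./2.+1 e) => //.
  - by lia.
  - by move=> f u fF uf; have := degF f u fF uf; lia.
  - by lia.
  move=> p pP; apply: (negP noP).
  by apply: sub_copy (linear_path_copy uF pP hP); apply/subsetP.
have {bound} : ex_lin r n P * 2 <= (2 * r - 3) * l * n by rewrite -leq_divRL.
rewrite -(Num.Theory.ler_nat rat) !GRing.natrM GRing.natrB; last by lia.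
by rewrite GRing.natrM; lra.
Qed.
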